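(* Let $\mathfrak{E},\mathfrak{H},\mathfrak{K}$ be Hilbert spaces and let $A\in\mathbf{B}(\mathfrak{E},\mathfrak{H})$ and $B\in\mathbf{B}(\mathfrak{E},\mathfrak{K})$ be bounded linear operators. Let $P$ be the orthogonal projection from $\mathfrak{K}$ onto $\mathfrak{D}(A,B)^\perp$, and put $B_{\rm reg}=(I-P)B$ and $B_{\rm sing}=PB$. Then $B_{\rm reg}$ is almost dominated by $A$, $B_{\rm sing}$ is singular with respect to $A$, and $B=B_{\rm reg}+B_{\rm sing}$. The regular part can be written as $$B_{\rm reg}=R(A,B_{\rm reg})A,$$ where $R(A,B_{\rm reg})=L(A,B_{\rm reg})^{**}$ is the Radon-Nikodym derivative of $B_{\rm reg}$ with respect to $A$. Moreover, with $L(A,B)_{\rm reg}=(I-P)L(A,B)$ and $L(A,B)_{\rm sing}=P\,L(A,B)$ one has $$L(A,B)_{\rm reg}=L(A,B_{\rm reg}),\qquad L(A,B)_{\rm sing}=L(A,B_{\rm sing}).$$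
   Context: $\mathbf{B}(\mathfrak{X},\mathfrak{Y})$ denotes the everywhere defined bounded linear operators from the Hilbert space $\mathfrak{X}$ to the Hilbert space $\mathfrak{Y}$; $\mathbf{B}(\mathfrak{X})=\mathbf{B}(\mathfrak{X},\mathfrak{X})$. A linear relation $T$ from $\mathfrak{H}$ to $\mathfrak{K}$ is a linear subspace of $\mathfrak{H}\times\mathfrak{K}$, with elements written $\{f,g\}$; operators are identified with their graphs. $T^{**}$ is the closure of $T$ in $\mathfrak{H}\times\mathfrak{K}$. For $Q\in\mathbf{B}(\mathfrak{K})$, $QT=\{\{f,Qg\}:\{f,g\}\in T\}$. For $A\in\mathbf{B}(\mathfrak{E},\mathfrak{H})$, $B\in\mathbf{B}(\mathfrak{E},\mathfrak{K})$: $L(A,B)=\{\{Af,Bf\}: f\in\mathfrak{E}\}$, a linear relation from $\mathfrak{H}$ to $\mathfrak{K}$, and $\mathfrak{D}(A,B)=\{k\in\mathfrak{K}: B^*k\in\operatorname{ran}A^*\}$. $D\prec A$ ($D$ is dominated by $A$) means there is $c>0$ with $\|Df\|\le c\|Af\|$ for all $f\in\mathfrak{E}$. $B$ is almost dominated by $A$ if there exist Hilbert spaces $\mathfrak{K}_n$, operators $B_n\in\mathbf{B}(\mathfrak{E},\mathfrak{K}_n)$ and numbers $c_n\ge0$ such that for all $f\in\mathfrak{E}$: (a) $\|B_nf\|\le c_n\|Af\|$; (b) $\|B_nf\|\le\|B_{n+1}f\|$; (c) $\|B_nf\|\nearrow\|Bf\|$. $B$ is singular with respect to $A$ if for every $D\in\mathbf{B}(\mathfrak{E})$: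 $D\prec A$ and $D\prec B$ imply $D=0$. If $B$ is almost dominated by $A$, then $L(A,B)^{**}$ is (the graph of) a closed linear operator from $\mathfrak{H}$ to $\mathfrak{K}$ (not necessarily densely defined or bounded), and the Radon-Nikodym derivative of $B$ with respect to $A$ is $R(A,B)=L(A,B)^{**}$. *)

(* Defs.v *)
From HB Require Import structures.
From mathcomp Require Import all_boot all_order all_algebra.
From mathcomp Require Import complex.
From mathcomp Require Import boolp classical_sets functions reals.
From mathcomp Require Import topology normedtype sequences.

Set Implicit Arguments.
Unset Strict Implicit.
Unset Printing Implicit Defensive.

Import Order.TTheory GRing.Theory Num.Theory.
Import numFieldNormedType.Exports.

Local Open Scope classical_set_scope.
Local Open Scope ring_scope.

(* Hilbert spaces may be real or complex.  Norms, and hence all bounds below,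
   take values in the scalar field, as for [normedModType]; over [R[i]] the
   order makes [0 <= c] imply that [c] is real. *)
Variant scalar_kind := RealScalars | ComplexScalars.

Definition scalar_field (R : realType) (s : scalar_kind) : numFieldType :=
  match s with RealScalars => R | ComplexScalars => R[i] end.

Definition scalar_conj (R : realType) (s : scalar_kind) :
    involutive_rmorphism (scalar_field R s) :=
  match s return involutive_rmorphism (scalar_field R s) with
  | RealScalars => idfun
  | ComplexScalars => @Num.conj R[i]
  end.

(* The inner product is linear in its first argument. *)
HB.mixin Record hasInner (R : realType) (s : scalar_kind) H
    & CompleteNormedModule (scalar_field R s) H := {
  inner : {dot H for scalar_conj R s} ;
  inner_norm : forall x : H, inner x x = `|x| ^+ 2 }.

#[short(type="hilbertType")]
HB.structure Definition Hilbert (R : realType) (s : scalar_kind) :=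
  { H of CompleteNormedModule (scalar_field R s) H & hasInner R s H }.

HB.mixin Record isBoundedMap (R : numFieldType) (V W : normedModType R)
    (f : V -> W) := {
  bounded_map : exists c : R, forall x, `|f x| <= c * `|x| }.

#[short(type="boundedOp")]
HB.structure Definition BoundedOp (R : numFieldType) (V W : normedModType R) :=
  { f of @GRing.Linear R V W *:%R f & @isBoundedMap R V W f }.

Notation "''B' ( V , W )" := (@BoundedOp.type _ V W)
  (at level 8, format "''B' ( V ,  W )") : type_scope.

Section bounded_operators.
Context (R : numFieldType) (U V W : normedModType R).

HB.instance Definition _ := gen_eqMixin 'B(V, W).
HB.instance Definition _ := gen_choiceMixin 'B(V, W).

Fact bounded_map_null : exists c : R, forall x, `|(\0 : V -> W) x| <= c * `|x|.
Proof. by exists 0 => x; rewrite normr0 mul0r. Qed.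

HB.instance Definition _ := isBoundedMap.Build R V W (\0 : V -> W) bounded_map_null.
HB.instance Definition _ := isPointed.Build 'B(V, W) (\0 : V -> W).

Fact bounded_map_id : exists c : R, forall x, `|(idfun : V -> V) x| <= c * `|x|.
Proof. by exists 1 => x; rewrite mul1r. Qed.

HB.instance Definition _ := isBoundedMap.Build R V V idfun bounded_map_id.

Fact bounded_map_sub (f g : 'B(V, W)) :
  exists c : R, forall x, `|(f \- g) x| <= c * `|x|.
Proof.
have [[c fc] [d gd]] := (@bounded_map _ _ _ f, @bounded_map _ _ _ g).
exists (c + d) => x; rewrite mulrDl; apply: le_trans (ler_normB _ _) _.
exact: lerD.
Qed.

HB.instance Definition _ (f g : 'B(V, W)) :=
  isBoundedMap.Build R V W (f \- g) (bounded_map_sub f g).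

Fact bounded_map_comp (f : 'B(U, V)) (g : 'B(V, W)) :
  exists c : R, forall x, `|(g \o f) x| <= c * `|x|.
Proof.
have [[c fc] [d gd]] := (@bounded_map _ _ _ f, @bounded_map _ _ _ g).
have d0 (y : V) : d * `|y| = `|d| * `|y|.
  by rewrite -[LHS]ger0_norm ?normrM ?normr_id // (le_trans _ (gd y)).
exists (`|d| * c) => x /=; rewrite -mulrA.
by apply: le_trans (gd _) _; rewrite d0 ler_wpM2l.
Qed.

HB.instance Definition _ (f : 'B(U, V)) (g : 'B(V, W)) :=
  isBoundedMap.Build R U W (g \o f) (bounded_map_comp f g).

End bounded_operators.

Section linear_relations.
Context (R : numFieldType) (E H K L : normedModType R).

(* Linear relations are represented by their underlying sets of pairs. *)
Definition graph (T : 'B(H, K)) : set (H * K) := [set p | p.2 = T p.1].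

(* [rel_comp S T] is the product "S T": first [T], then [S]. *)
Definition rel_comp (S : set (H * K)) (T : set (E * H)) : set (E * K) :=
  [set p | exists2 g, T (p.1, g) & S (g, p.2)].

Definition op_mul_rel (Q : 'B(K, L)) (T : set (H * K)) : set (H * L) :=
  [set (p.1, Q p.2) | p in T].

Definition opL (A : 'B(E, H)) (B : 'B(E, K)) : set (H * K) :=
  [set (A f, B f) | f in setT].

Definition dominated (D : 'B(E, K)) (A : 'B(E, H)) : Prop :=
  exists2 c : R, 0 < c & forall f, `|D f| <= c * `|A f|.

(* The closure is taken in the product topology of [H * K]. *)
Definition RN_derivative (A : 'B(E, H)) (B : 'B(E, K)) : set (H * K) :=
  closure (opL A B).

End linear_relations.

Section Hilbert_operators.
Context (R : realType) (s : scalar_kind).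
Implicit Types E H K : hilbertType R s.

Definition orthocomp H (M : set H) : set H :=
  [set x | forall y, M y -> inner x y = 0].

Definition is_orthoproj H (M : set H) (P : 'B(H, H)) : Prop :=
  forall x, M (P x) /\ orthocomp M (x - P x).

(* A default value is returned when no orthogonal projection onto [M] exists,
   which does not happen when [M] is a closed subspace. *)
Definition orthoproj H (M : set H) : 'B(H, H) := get (is_orthoproj M).

(* The adjoint always exists, by the Riesz representation theorem. *)
Definition adjoint H K (B : 'B(H, K)) : 'B(K, H) :=
  get [set C : 'B(K, H) | forall f k, inner (B f) k = inner f (C k)].

Definition frakD E H K (A : 'B(E, H)) (B : 'B(E, K)) : set K :=
  [set k | range (adjoint A) (adjoint B k)].

Definition almost_dominated E H K (B : 'B(E, K)) (A : 'B(E, H)) : Prop :=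
  exists (Kn : nat -> hilbertType R s) (Bn : forall n, 'B(E, Kn n))
         (c : nat -> scalar_field R s),
    (forall n, 0 <= c n) /\
    forall f,
      [/\ forall n, `|Bn n f| <= c n * `|A f|,
          forall n, `|Bn n f| <= `|Bn n.+1 f| &
          `|Bn n f| @[n --> \oo] --> `|B f| ].

Definition singular E H K (B : 'B(E, K)) (A : 'B(E, H)) : Prop :=
  forall D : 'B(E, E), dominated D A -> dominated D B -> forall f, D f = 0.

End Hilbert_operators.

(* Main.v *)
Require Import Defs.
From HB Require Import structures.
From mathcomp Require Import all_boot all_order all_algebra.
From mathcomp Require Import boolp classical_sets functions reals.
From mathcomp Require Import topology normedtype sequences.
From mathcomp Require Import complex ring.

Import Order.TTheory GRing.Theory Num.Theory.
Import numFieldNormedType.Exports.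

Local Open Scope classical_set_scope.
Local Open Scope ring_scope.

Set Implicit Arguments.
Unset Strict Implicit.
Unset Printing Implicit Defensive.

(** Write [D] for the subspace [frakD A B]; by the definition of the adjoint,
    [x] lies in [D] exactly when some [h] satisfies
    [inner (B f) x = inner (A f) h] for all [f].  So [D] is the domain of the
    adjoint relation of L(A, B), and everything follows from the orthogonal
    projection theorem, used in [K], in [E] (for the Riesz theorem, hence for
    adjoints) and in the direct sum of [K] and [H].

    Almost domination.  For [d > 0] project the pair [(k, 0)] orthogonally onto
    the closed subspace of all [(x, g)] with
    [inner (B f) x = d * inner (A f) g], and let [C_d k] be the first component
    of the projection.  With T the closure of L(A, B), this is the operator
    (1 + TT* / d^2)^-1.  It annihilates the orthocomplement of [D], so
    [C_d (B f) = C_d (Breg f)]; it satisfies [`|C_d (B f)| <= d * `|A f|]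
    ([resolvent_dominated]); its norm is nondecreasing in [d]
    ([resolvent_le]), by a form of the resolvent identity; and [C_d k] tends to
    [k] on the closure of [D], because [C_d k] comes from a distance minimizer
    ([resolvent_min]).  Hence the operators [C_n \o B] witness the almost
    domination of [Breg].

    Singularity.  If [k] is orthogonal to [D], then [(k, 0)] is orthogonal to
    the orthocomplement of the subspace of pairs [(B g, - A g)], hence is a
    limit of such pairs.  For [k = Bsing f] this produces [g] with [A g]
    near 0 and [B g] near [k], so that [Bsing (f - g)] is near 0 as well; an
    operator dominated by both [A] and [Bsing] then vanishes at [f].

    Radon-Nikodym derivative.  If [(A f, k)] lies in the closure of
    L(A, Breg), then testing against the elements of [D] shows that
    [k - Breg f] is orthogonal to [D], while it is also a limit of elements of
    the closure of [D]; hence [k = Breg f] ([RN_derivative_single]). *)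

(** * Scalars *)

Section scalars.
Context (R : realType) (s : scalar_kind).
Local Notation F := (scalar_field R s).
Local Notation conj := (scalar_conj R s).

Lemma scalar_normCK (a : F) : a * conj a = `|a| ^+ 2.
Proof. by case: s a => /= a; rewrite ?normCK // real_normK ?num_real. Qed.

Lemma scalar_conj_ge0 (a : F) : 0 <= a -> conj a = a.
Proof. by case: s a => /= a a0 //; rewrite geC0_conj. Qed.

(** Norms live in the scalar field, which is only partially ordered over the
    complex numbers; minimizing sequences are obtained from this lemma instead
    of from an infimum in the field. *)
Lemma scalar_approx_inf (T : Type) (D : T -> Prop) (g : T -> F) (e : F) :
    (exists x, D x) -> (forall x, D x -> 0 <= g x) -> 0 < e ->
  exists2 x, D x & forall y, D y -> g x <= g y + e.
Proof.
have real_inf (h : T -> R) (d : R) : (exists x, D x) ->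
    (forall x, D x -> 0 <= h x) -> 0 < d ->
    exists2 x, D x & forall y, D y -> h x <= h y + d.
  move=> [x0 Dx0] h0 d0.
  have hi : has_inf (h @` D).
    by split; [exists (h x0), x0 | exists 0 => _ [x Dx <-]; exact: h0].
  have [_ [x Dx <-] hx] := inf_adherent d0 hi.
  exists x => // y Dy; apply/ltW/(lt_le_trans hx); rewrite lerD2r.
  by apply: ge_inf; [exact: hi.2 | exists y].
case: s g e => /= g e Dn g0 e0; first exact: real_inf.
have nnegE (z : R[i]) : 0 <= z -> z = (complex.Re z)%:C%C.
  by case: z => a b; rewrite lecE /= => /andP[/eqP-> _].
have Re_ge0 (z : R[i]) : 0 <= z -> 0 <= complex.Re z.
  by case: z => a b; rewrite lecE /= => /andP[].
have [||x Dx hx] := real_inf (fun x => complex.Re (g x)) (complex.Re e) Dn.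
- by move=> x Dx; apply/Re_ge0/g0.
- by move: e0; rewrite ltcE => /andP[].
exists x => // y Dy; rewrite (nnegE _ (g0 _ Dx)) (nnegE _ (g0 _ Dy)).
by rewrite (nnegE _ (ltW e0)) -rmorphD lecR hx.
Qed.

Lemma scalar_approx0 (a : F) : 0 <= a -> (forall e, 0 < e -> a < e) -> a = 0.
Proof.
move=> a0 ae; apply/eqP/contraT => an0.
by have := ae a; rewrite lt_def an0 a0 ltxx => /(_ isT).
Qed.

Lemma scalar_archi (e : F) : 0 < e -> exists n, n.+1%:R^-1 < e.
Proof.
have real_archi (d : R) : 0 < d -> exists n, n.+1%:R^-1 < d.
  move=> d0; exists (Num.bound d^-1); rewrite -[ltRHS]invrK ltf_pV2 ?posrE ?ltr0n ?invr_gt0//.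
  have /archi_boundP hb : 0 <= d^-1 by rewrite invr_ge0 ltW.
  by apply: (lt_le_trans hb); rewrite ler_nat.
case: s e => /= e e0; first exact: real_archi.
have [|n hn] := real_archi (complex.Re e); first by move: e0; rewrite ltcE => /andP[].
exists n; move: e0 hn; case: e => a b; rewrite ltcE /= => /andP[/eqP -> _] hn.
by rewrite -(rmorph_nat (@real_complex R)) -fmorphV ltcR.
Qed.

End scalars.

(** * Orthogonal projection for a complete scalar product *)

Section dot_products.
Context (R : realType) (s : scalar_kind) (V : lmodType (scalar_field R s)).
Variable f : {dot V for scalar_conj R s}.
Local Notation F := (scalar_field R s).
Local Notation conj := (scalar_conj R s).
Implicit Types (u v w : V) (a : F) (M : set V).

Lemma dotC u v : f v u = conj (f u v).
Proof. by rewrite (hermC f v u) expr0 mul1r. Qed.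

Lemma dotZl a u v : f (a *: u) v = a * f u v.
Proof. exact: linearZl_LR. Qed.

Lemma dotZr a u v : f u (a *: v) = conj a * f u v.
Proof. exact: linearZr_LR. Qed.

Lemma dot0l v : f 0 v = 0.
Proof. exact: linear0l. Qed.

Lemma dot0r u : f u 0 = 0.
Proof. exact: linear0r. Qed.

Lemma dotDl u v w : f (u + v) w = f u w + f v w.
Proof. exact: linearDl. Qed.

Lemma dotDr u v w : f u (v + w) = f u v + f u w.
Proof. exact: linearDr. Qed.

Lemma dotNl u v : f (- u) v = - f u v.
Proof. exact: linearNl. Qed.

Lemma dotNr u v : f u (- v) = - f u v.
Proof. exact: linearNr. Qed.

Lemma dotBl u v w : f (u - v) w = f u w - f v w.
Proof. exact: linearBl. Qed.

Lemma dotBr u v w : f u (v - w) = f u v - f u w.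
Proof. exact: linearBr. Qed.

Lemma dot_gt0 u : u != 0 -> 0 < f u u.
Proof. exact: neq0_dnorm_gt0. Qed.

Lemma dot_ge0 u : 0 <= f u u.
Proof. by have [->|/dot_gt0/ltW//] := eqVneq u 0; rewrite dot0l. Qed.

Lemma dot_eq0 u : f u u = 0 -> u = 0.
Proof. by have [//|/dot_gt0] := eqVneq u 0; rewrite lt_def => /andP[/eqP]. Qed.

Lemma dot_conj u : conj (f u u) = f u u.
Proof. by rewrite -dotC. Qed.

Lemma dot_sym0 u v : f u v = 0 -> f v u = 0.
Proof. by move=> uv; rewrite dotC uv rmorph0. Qed.

(** Expand the nonnegative square of [f v v *: u - f u v *: v]. *)
Lemma dot_CauchySchwarz u v : `|f u v| ^+ 2 <= f u u * f v v.
Proof.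
have [->|v0] := eqVneq v 0; first by rewrite !dot0r normr0 expr0n mulr0.
have := dot_ge0 (f v v *: u - f u v *: v).
rewrite dotBl !dotBr !dotZl !dotZr !dot_conj [f v u]dotC.
rewrite [leRHS](_ : _ = f v v * (f u u * f v v - f u v * conj (f u v))); last by ring.
by rewrite scalar_normCK pmulr_rge0 ?dot_gt0// subr_ge0.
Qed.

Lemma dot_sub_scale w m (c : F) : conj c = c ->
  f (w - (c * f w m) *: m) (w - (c * f w m) *: m) =
  f w w - c * `|f w m| ^+ 2 * (2%:R - c * f m m).
Proof.
move=> cr; rewrite dotBl !dotBr !dotZl !dotZr rmorphM /= cr [f m w]dotC.
by rewrite -scalar_normCK; ring.
Qed.

(** Closure for the norm of [f], expressed without a topology on [V], so that
    it also applies to a direct sum carrying only a scalar product. *)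
Definition approx M : set V :=
  [set v | forall e : F, 0 < e -> exists2 m, M m & f (v - m) (v - m) < e].

Definition dot_orthocomp M : set V := [set u | forall m, M m -> f u m = 0].

Definition linear_set M := M 0 /\ forall a u v, M u -> M v -> M (a *: u + v).

(** Completeness is asked only for sequences that are Cauchy at a fixed rate,
    which is the rate that minimizing sequences have. *)
Definition dot_complete := forall u : nat -> V,
  (forall i j, f (u i - u j) (u i - u j) <= i.+1%:R^-1 + j.+1%:R^-1) ->
  exists l, forall e : F, 0 < e ->
    exists N, forall n, (N <= n)%N -> f (l - u n) (l - u n) < e.

Lemma approx_orthocomp M v w : approx M v -> dot_orthocomp M w -> f w v = 0.
Proof.
move=> Mv Mw; apply/eqP; rewrite -normr_eq0 -sqrf_eq0; apply/eqP.
apply: scalar_approx0 => [|e e0]; first exact: exprn_ge0.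
have c0 : 0 < f w w + 1 by rewrite ltr_wpDl ?dot_ge0.
have [|m Mm vm] := Mv (e / (f w w + 1)); first exact: divr_gt0.
rewrite -(subrK m v) dotDr (Mw _ Mm) addr0.
apply: (le_lt_trans (dot_CauchySchwarz _ _)).
move: vm; rewrite ltr_pdivlMr// mulrC; apply: le_lt_trans.
by rewrite ler_wpM2r ?dot_ge0// lerDl.
Qed.

Lemma approx_orthocomp0 M v : approx M v -> dot_orthocomp M v -> v = 0.
Proof. by move=> Mv /(approx_orthocomp Mv)/dot_eq0. Qed.

Lemma dot_orthocomp_linear M : linear_set (dot_orthocomp M).
Proof.
split=> [m _|a u v Mu Mv m Mm]; first by rewrite dot0l.
by rewrite dotDl dotZl Mu// Mv// mulr0 addr0.
Qed.

Lemma approx_dot_orthocomp M v :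
  approx (dot_orthocomp M) v -> dot_orthocomp M v.
Proof.
move=> Mv m Mm; apply: dot_sym0; apply: (approx_orthocomp Mv) => w Mw.
by apply: dot_sym0; apply: Mw.
Qed.

(** Along a sequence in [M] whose distance to [v] is almost minimal, the
    parallelogram identity gives the Cauchy property, and comparison with a
    small multiple of [m] gives orthogonality to [m] in the limit. *)
Lemma projection_exists M v : dot_complete -> linear_set M ->
  exists2 p, approx M p & dot_orthocomp M (v - p).
Proof.
move=> Vc [M0 Ml].
pose d m := f (v - m) (v - m).
pose eps n : F := (n.+1%:R)^-1 / 4%:R.
have eps0 n : 0 < eps n by rewrite divr_gt0 ?invr_gt0 ?ltr0n.
have /choice[u Mu] n : exists m, M m /\ forall y, M y -> d m <= d y + eps n.
  have [||m] := @scalar_approx_inf R s V M d (eps n) _ _ (eps0 n); first by exists 0.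
    by move=> x _; apply: dot_ge0.
  by exists m.
have [|p up] := Vc u.
  (* The parallelogram identity turns almost minimality into this bound. *)
  move=> i j; have Mmid : M (2%:R^-1 *: (u i + u j)).
    rewrite -[_ *: _]addr0 -[u i]scale1r; apply: (Ml) M0; apply: (Ml).
      exact: (Mu i).1.
    exact: (Mu j).1.
  have -> : f (u i - u j) (u i - u j) =
     (d (u i) + d (u j) - d (2%:R^-1 *: (u i + u j)) *+ 2) *+ 2.
    have half : conj 2%:R^-1 = 2%:R^-1 by rewrite scalar_conj_ge0// invr_ge0 ler0n.
    rewrite /d !(dotBl, dotBr, dotDl, dotDr, dotZl, dotZr).
    by rewrite half; field; rewrite ?pnatr_eq0.
  have [hi hj] := ((Mu i).2 _ Mmid, (Mu j).2 _ Mmid).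
  have -> : i.+1%:R^-1 + j.+1%:R^-1 = ((eps i + eps j) *+ 2) *+ 2 :> F.
    rewrite /eps; move: (i.+1%:R^-1) (j.+1%:R^-1) => x y.
    by field.
  rewrite lerMn2r /= (@le_trans _ _ (eps i + eps j))//.
    by rewrite lerBlDr (le_trans (lerD hi hj))// mulr2n addrACA addrC.
  by rewrite mulr2n lerDl addr_ge0// ltW.
have Mp : approx M p.
  by move=> e /up[N /(_ _ (leqnn N)) ?]; exists (u N) => //; exact: (Mu N).1.
exists p => // m Mm.
(* Perturb [u n] by [c * f (v - u n) m *: m] with [c = (f m m + 1)^-1], a
   step small enough for the linear term to dominate the quadratic one. *)
have small n : `|f (v - u n) m| ^+ 2 <= (f m m + 1) * eps n.
  set a := f (v - u n) m.
  have c0 : 0 < f m m + 1 by rewrite ltr_wpDl ?dot_ge0.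
  have cr : conj (f m m + 1)^-1 = (f m m + 1)^-1.
    by rewrite scalar_conj_ge0// invr_ge0 ltW.
  have := (Mu n).2 (((f m m + 1)^-1 * a) *: m + u n) (Ml _ _ _ Mm (Mu n).1).
  rewrite /d [v - (_ + _)](_ : _ = (v - u n) - ((f m m + 1)^-1 * a) *: m); last first.
    by rewrite opprD addrA addrAC.
  rewrite (dot_sub_scale _ _ cr) -/a -subr_ge0.
  have -> : (f m m + 1)^-1 * f m m = 1 - (f m m + 1)^-1.
    by rewrite -[X in _ * X](addrK 1) mulrBr mulVf ?mulr1// gt_eqF.
  rewrite [leRHS](_ : _ =
    eps n - (f m m + 1)^-1 * `|a| ^+ 2 * (1 + (f m m + 1)^-1)); last first.
    by move: ((f m m + 1)^-1) (eps n) (`|a|) (f _ _) => x y z t; ring.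
  rewrite subr_ge0 => h.
  rewrite -ler_pdivrMl//; apply: le_trans h.
  by rewrite ler_peMr ?mulr_ge0 ?invr_ge0 ?exprn_ge0 ?(ltW c0)// lerDl invr_ge0 ltW.
apply/eqP; rewrite -normr_eq0 -sqrf_eq0; apply/eqP.
apply: scalar_approx0 => [|e e0]; first exact: exprn_ge0.
have c0 : 0 < f m m + 1 by rewrite ltr_wpDl ?dot_ge0.
have [|N1 hN1] := up (e / 4%:R / (f m m + 1)); first by rewrite !divr_gt0.
have [|N2 hN2] := @scalar_archi R s (e / (f m m + 1)); first exact: divr_gt0.
pose n := maxn N1 N2.
have -> : v - p = (v - u n) - (p - u n) by rewrite opprB addrA subrK.
rewrite dotBl.
have sq (a b : F) : `|a - b| ^+ 2 <= (`|a| ^+ 2 + `|b| ^+ 2) *+ 2.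
  apply: (@le_trans _ _ ((`|a| + `|b|) ^+ 2)).
    by rewrite lerXn2r ?nnegrE ?addr_ge0// ler_normB.
  rewrite -subr_ge0 [leRHS](_ : _ = (`|a| - `|b|) ^+ 2); last by ring.
  by rewrite real_exprn_even_ge0// rpredB// normr_real.
apply: (le_lt_trans (sq _ _)).
have -> : e = (e / 4%:R + e / 4%:R) *+ 2 by field.
rewrite ltrMn2r /=; apply: ler_ltD.
  apply: (le_trans (small n)); rewrite /eps mulrA ler_pM2r ?invr_gt0//.
  rewrite -ler_pdivlMl// mulrC; apply: le_trans (ltW hN2).
  by rewrite lef_pV2 ?posrE ?ltr0n// ler_nat ltnS leq_maxr.
apply: (le_lt_trans (dot_CauchySchwarz _ _)).
have := hN1 _ (leq_maxl N1 N2); rewrite -/n ltr_pdivlMr//; apply: le_lt_trans.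
by rewrite ler_wpM2l ?dot_ge0// lerDl.
Qed.

(** The double orthocomplement description makes it immediate that closures of
    subspaces are subspaces. *)
Lemma approx_biorthP M v : dot_complete -> linear_set M ->
  approx M v <-> dot_orthocomp (dot_orthocomp M) v.
Proof.
move=> Vc Ml; split=> [Mv w Mw|Mv]; first exact/dot_sym0/(approx_orthocomp Mv).
have [p Mp vp] := projection_exists v Vc Ml.
suff -> : v = p by [].
by apply/subr0_eq/dot_eq0; rewrite dotBl Mv// (dot_sym0 (approx_orthocomp Mp vp)) subrr.
Qed.

End dot_products.

(** * Bounded operators between Hilbert spaces *)

Section bounded_maps.
Context (F : numFieldType) (V W : normedModType F).

Lemma bounded_map_ge0 (T : 'B(V, W)) :
  exists2 c : F, 0 <= c & forall x, `|T x| <= c * `|x|.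
Proof.
have [c hc] := @bounded_map _ _ _ T; exists `|c| => // x.
apply: (le_trans (hc x)); have cx0 : 0 <= c * `|x| by apply: le_trans (hc x).
by rewrite -(ger0_norm cx0) normrM normr_id.
Qed.

Lemma boundedOp_of_fun (g : V -> W) (c : F) :
    (forall a u v, g (a *: u + v) = a *: g u + g v) ->
    (forall x, `|g x| <= c * `|x|) ->
  exists T : 'B(V, W), forall x, T x = g x.
Proof.
move=> gl gc.
pose L := GRing.isLinear.Build F V W *:%R g gl.
pose b := isBoundedMap.Build F V W g (ex_intro _ c gc).
pose T : 'B(V, W) := HB.pack g L b.
by exists T.
Qed.

(** A total, linear and bounded relation is single-valued: the bound applied
    to the difference of two values at a point forces it to be zero. *)
Lemma boundedOp_of_rel (G : V -> W -> Prop) (c : F) :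
    (forall v, exists w, G v w) ->
    (forall a v w v' w', G v w -> G v' w' -> G (a *: v + v') (a *: w + w')) ->
    (forall v w, G v w -> `|w| <= c * `|v|) ->
  exists T : 'B(V, W), forall v, G v (T v).
Proof.
move=> /choice[g Gg] Gl Gc.
have G_inj v w w' : G v w -> G v w' -> w = w'.
  move=> Gw Gw'; apply/eqP; rewrite -subr_eq0 -normr_le0.
  have := Gl (-1) _ _ _ _ Gw' Gw; rewrite !scaleN1r addNr => /Gc.
  by rewrite normr0 mulr0 addrC.
have gl a u v : g (a *: u + v) = a *: g u + g v.
  by apply: G_inj (Gg _) _; apply: Gl.
have [|T Tg] := @boundedOp_of_fun g c gl; first by move=> x; apply: Gc.
by exists T => v; rewrite Tg.
Qed.

End bounded_maps.

Section Hilbert_spaces.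
Context (R : realType) (s : scalar_kind).
Local Notation F := (scalar_field R s).
Local Notation conj := (scalar_conj R s).
Implicit Types (E H K : hilbertType R s).

Lemma inner_CauchySchwarz H (x y : H) : `|inner x y| <= `|x| * `|y|.
Proof.
rewrite -(@ler_pXn2r _ 2) ?nnegrE ?mulr_ge0// exprMn -!inner_norm.
exact: dot_CauchySchwarz.
Qed.

Lemma inner_complete H : dot_complete (@inner R s H).
Proof.
move=> u uc; have : cauchy (u @ \oo).
  apply: cauchy_exP => e e0.
  have [|N hN] := @scalar_archi R s (e ^+ 2 / 2%:R).
    by rewrite divr_gt0// exprn_gt0.
  exists (u N); exists N => // n /= Nn; rewrite -ball_normE /=.
  rewrite -(@ltr_pXn2r _ 2) ?nnegrE ?(ltW e0)// -inner_norm.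
  apply: (le_lt_trans (uc _ _)); rewrite (splitr (e ^+ 2)) ltr_leD//.
  apply: le_trans (ltW hN).
  by rewrite lef_pV2 ?posrE ?ltr0n// ler_nat ltnS.
move=> /cauchy_cvg /cvg_ex[l /cvgrPdist_lt ul]; exists l => e e0.
(* [e1] bounds both the distance by 1 and its square by [e]. *)
have [e1 [e10 e11 e1e]] : exists e1 : F, [/\ 0 < e1, e1 <= 1 & e1 <= e].
  have d0 : 0 < 1 + e by rewrite ltr_wpDl// ?ler01.
  exists (e / (1 + e)); rewrite divr_gt0//; split=> //.
    by rewrite ler_pdivrMr// mul1r lerDr.
  by rewrite ler_pdivrMr// ler_peMr ?(ltW e0)// lerDl ltW.
have [N _ hN] := ul e1 e10.
exists N => n /hN; rewrite inner_norm; set a := `|_| => h.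
apply: lt_le_trans e1e; apply: le_lt_trans (h).
have a1 : a <= 1 by apply/ltW/(lt_le_trans h).
by rewrite expr2 ler_piMr ?normr_ge0.
Qed.

Lemma inner_ext H (x y : H) : (forall z, inner z x = inner z y) -> x = y.
Proof.
by move=> xy; apply/subr0_eq/(dot_eq0 (f := @inner R s H)); rewrite dotBr xy subrr.
Qed.

Lemma approx_norm H (M : set H) v (e : F) : approx (@inner R s H) M v -> 0 < e ->
  exists2 m, M m & `|v - m| < e.
Proof.
move=> Mv e0; have [|m Mm vm] := Mv (e ^+ 2); first exact: exprn_gt0.
by exists m => //; rewrite -(@ltr_pXn2r _ 2) ?nnegrE ?(ltW e0)// -inner_norm.
Qed.

(** The functional [f |-> inner (B f) k] is represented by a multiple of any
    nonzero vector orthogonal to its kernel. *)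
Lemma Riesz_representation E K (B : 'B(E, K)) k :
  exists g, forall f, inner (B f) k = inner f g.
Proof.
have [[v Bv0]|/forallNP B0] := pselect (exists v, inner (B v) k <> 0); last first.
  by exists 0 => f; rewrite dot0r; apply: contrapT => Bf; exact: (B0 f Bf).
pose N := [set f | inner (B f) k = 0].
have Nl : linear_set N.
  split=> [|a x y]; rewrite /N /= ?linear0 ?dot0l// => xN yN.
  by rewrite linearP dotDl dotZl xN yN mulr0 addr0.
have [p Np vp] := projection_exists v (@inner_complete E) Nl.
have [c c0 Bc] := bounded_map_ge0 B.
have pN : inner (B p) k = 0.
  apply/eqP; rewrite -normr_eq0; apply/eqP.
  apply: scalar_approx0 => // e e0.
  have d0 : 0 < c * `|k| + 1 by rewrite ltr_wpDl ?mulr_ge0.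
  have [|m Nm pm] := approx_norm (e := e / (c * `|k| + 1)) Np; first exact: divr_gt0.
  rewrite -[p](subrK m) linearD dotDl Nm addr0.
  apply: (le_lt_trans (inner_CauchySchwarz _ _)).
  move: pm; rewrite ltr_pdivlMr//; apply: le_lt_trans.
  apply: (@le_trans _ _ (c * `|p - m| * `|k|)); first exact/ler_wpM2r/Bc.
  by rewrite mulrAC mulrC ler_wpM2l// lerDl.
pose u := v - p.
have Bu : inner (B u) k = inner (B v) k by rewrite linearB dotBl pN subr0.
have u0 : inner u u != 0.
  by apply/eqP => /dot_eq0 u0; apply: Bv0; rewrite -Bu u0 linear0 dot0l.
have Bu0 : inner (B u) k != 0 by rewrite Bu; apply/eqP.
exists (conj (inner (B u) k / inner u u) *: u) => f.
rewrite dotZr rmorphK.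
have : inner u (f - (inner (B f) k / inner (B u) k) *: u) = 0.
  by apply: vp; rewrite /N /= linearB linearZ_LR dotBl dotZl divfK ?subrr.
move/dot_sym0; rewrite dotBl dotZl => /subr0_eq ->.
by rewrite mulrCA !divfK.
Qed.

Lemma adjointP E K (B : 'B(E, K)) f k : inner (B f) k = inner f (adjoint B k).
Proof.
suff [C hC] : exists C : 'B(K, E), forall f k, inner (B f) k = inner f (C k).
  have := @getPex _ [set C : 'B(K, E) | forall f k, inner (B f) k = inner f (C k)].
  by apply; exists C.
have [c c0 Bc] := bounded_map_ge0 B.
have [|||C hC] := @boundedOp_of_rel _ K E (fun k g => forall f, inner (B f) k = inner f g) c.
- exact: Riesz_representation.
- by move=> a v w v' w' vw vw' g; rewrite !dotDr !dotZr vw vw'.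
- move=> v w vw; have [->|w0] := eqVneq w 0; first by rewrite normr0 mulr_ge0.
  rewrite -(@ler_pM2r _ `|w|) ?normr_gt0// -expr2 -inner_norm -vw.
  apply: (@le_trans _ _ (`|B w| * `|v|)); last by rewrite mulrAC; exact/ler_wpM2r/Bc.
  apply: le_trans (inner_CauchySchwarz _ _).
  by rewrite vw inner_norm ger0_norm// exprn_ge0.
by exists C => f' k'; apply: hC.
Qed.

(** The domain of the adjoint relation of L(A, B): the form of [frakD] in
    which it is used throughout. *)
Lemma frakDP E H K (A : 'B(E, H)) (B : 'B(E, K)) k :
  frakD A B k <-> exists h, forall f, inner (B f) k = inner (A f) h.
Proof.
split=> [[h _ hk]|[h hk]]; exists h => //.
  by move=> f; rewrite !adjointP hk.
by apply: inner_ext => f; rewrite -!adjointP hk.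
Qed.

(** The projection onto the orthocomplement of [M] is the complement of the
    projection onto the closure of [M]; hence [x - P x] is a limit of elements
    of [M], which is how the regular part is approximated. *)
Lemma orthoproj_orthocompP H (M : set H) : linear_set M ->
  let P := orthoproj (orthocomp M) in
  [/\ forall x, orthocomp M (P x),
      forall x, approx (@inner R s H) M (x - P x) &
      forall x, `|P x| <= `|x| ].
Proof.
move=> Ml P; pose G x y := orthocomp M y /\ approx (@inner R s H) M (x - y).
have Gc x y : G x y -> `|y| <= `|x|.
  move=> [My Mxy]; rewrite -(@ler_pXn2r _ 2) ?nnegrE// -!inner_norm.
  have yxy := approx_orthocomp Mxy My.
  rewrite -{1 2}[x](subrK y); move: (x - y) yxy => z yz.
  rewrite dotDl !dotDr yz (dot_sym0 yz).
  by rewrite addr0 add0r lerDr dot_ge0.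
have [|||Q GQ] := @boundedOp_of_rel _ H H G 1.
- move=> x; have [p Mp xp] := projection_exists x (@inner_complete H) Ml.
  by exists (x - p); split=> //; rewrite opprB addrC subrK.
- move=> a x y x' y' [My xy] [My' xy']; split.
    by move=> m Mm; rewrite dotDl dotZl My// My'// mulr0 addr0.
  move: xy xy' => /(approx_biorthP _ (@inner_complete H) Ml) xy.
  move=> /(approx_biorthP _ (@inner_complete H) Ml) xy'.
  apply/(approx_biorthP _ (@inner_complete H) Ml) => w Mw.
  rewrite (_ : _ - _ = a *: (x - y) + (x' - y')).
    by rewrite dotDl dotZl xy// xy'// mulr0 addr0.
  by rewrite scalerBr opprD addrACA.
- by move=> x y /Gc; rewrite mul1r.
have MP : is_orthoproj (orthocomp M) P.
  have := @getPex _ [set P : 'B(H, H) | is_orthoproj (orthocomp M) P].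
  apply; exists Q => x; split; first exact: (GQ x).1.
  by move=> y My; apply/dot_sym0/(approx_orthocomp (GQ x).2).
have PQ x : P x = Q x.
  apply/subr0_eq/(dot_eq0 (f := @inner R s H)).
  have M_PQ : orthocomp M (P x - Q x).
    by move=> m Mm; rewrite dotBl (MP x).1// (GQ x).1// subrr.
  rewrite -[X in inner X](_ : (x - Q x) - (x - P x) = _); last first.
    by rewrite opprB [LHS]addrC addrA subrK.
  by rewrite dotBl (MP x).2// (dot_sym0 (approx_orthocomp (GQ x).2 M_PQ)) subrr.
by split=> x; rewrite PQ; [exact: (GQ x).1 | exact: (GQ x).2 | exact: Gc (GQ x)].
Qed.

End Hilbert_spaces.

(** * The direct sum of two Hilbert spaces *)

Section direct_sum.
Context (R : realType) (s : scalar_kind) (K H : hilbertType R s).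
Local Notation F := (scalar_field R s).
Local Notation conj := (scalar_conj R s).

Definition pair_inner (x y : K * H) : F := inner x.1 y.1 + inner x.2 y.2.

Fact pair_inner_zmodl y : zmod_morphism (pair_inner ^~ y).
Proof. by move=> x z; rewrite /pair_inner !dotBl addrACA opprD. Qed.

Fact pair_inner_zmodr x : zmod_morphism (pair_inner x).
Proof. by move=> y z; rewrite /pair_inner !dotBr addrACA opprD. Qed.

Fact pair_inner_scalel y : scalable_for *%R (pair_inner ^~ y).
Proof. by move=> a x; rewrite /pair_inner !dotZl mulrDr. Qed.

Fact pair_inner_scaler x : scalable_for (conj \; *%R) (pair_inner x).
Proof. by move=> a y; rewrite /pair_inner !dotZr /= mulrDr. Qed.

HB.instance Definition _ := isBilinear.Build F (K * H)%type (K * H)%type F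
  *%R (conj \; *%R) pair_inner
  pair_inner_zmodl pair_inner_zmodr pair_inner_scalel pair_inner_scaler.

Fact pair_inner_herm x y :
  pair_inner x y = (-1) ^+ false * conj (pair_inner y x).
Proof. by rewrite mul1r rmorphD /= -!dotC. Qed.

HB.instance Definition _ := isHermitianSesquilinear.Build F (K * H)%type
  false conj pair_inner pair_inner_herm.

Fact pair_inner_gt0 x : x != 0 -> 0 < pair_inner x x.
Proof.
case: x => x y xy0; rewrite lt_def addr_ge0 ?dot_ge0// andbT.
rewrite paddr_eq0 ?dot_ge0//; apply: contra xy0.
move=> /andP[/eqP/dot_eq0 /= -> /eqP/dot_eq0 /= ->].
exact: eqxx.
Qed.

HB.instance Definition _ := isDotProduct.Build F (K * H)%type pair_inner
  pair_inner_gt0.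

Lemma pair_inner_complete : dot_complete pair_inner.
Proof.
move=> u uc.
have [|x ux] := @inner_complete _ _ K (fst \o u).
  by move=> i j; apply: le_trans (uc i j); rewrite lerDl dot_ge0.
have [|y uy] := @inner_complete _ _ H (snd \o u).
  by move=> i j; apply: le_trans (uc i j); rewrite lerDr dot_ge0.
exists (x, y) => e e0; have e2 : 0 < e / 2%:R by rewrite divr_gt0.
have [[N1 h1] [N2 h2]] := (ux _ e2, uy _ e2).
exists (maxn N1 N2) => n; rewrite geq_max => /andP[/h1 ? /h2 ?].
by rewrite (splitr e) ltrD.
Qed.

End direct_sum.

(** * The adjoint relation and its resolvents *)

Section operator_range.
Context (R : realType) (s : scalar_kind) (E H K : hilbertType R s).
Context (A : 'B(E, H)) (B : 'B(E, K)).
Local Notation F := (scalar_field R s).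
Local Notation conj := (scalar_conj R s).
Local Notation pdot := (@pair_inner R s K H).

(** Up to the order of the components, this is the relation L(d A, B) with a
    sign that makes its orthocomplement the adjoint relation.  The parameter
    [d] plays the role of a weight on [H], so that a single scalar product on
    the direct sum serves for all resolvents. *)
Definition tilted_range (d : F) : set (K * H) :=
  range (fun f => (B f, - (d *: A f))).

Definition tilted_adjoint d := dot_orthocomp pdot (tilted_range d).

Lemma tilted_adjointE d x g : conj d = d ->
  tilted_adjoint d (x, g) <-> forall f, inner (B f) x = d * inner (A f) g.
Proof.
move=> dd; have dotE f : pdot (x, g) (B f, - (d *: A f)) =
    conj (inner (B f) x - d * inner (A f) g).
  rewrite /pair_inner -scaleNr dotZr rmorphN rmorphB rmorphM /= !dd.
  by rewrite -!dotC mulNr.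
split=> [xg f|xg _ [f _ <-]]; last first.
  by apply: etrans (dotE f) _; rewrite xg subrr rmorph0.
have /(congr1 conj) := etrans (esym (dotE f)) (xg _ (ex_intro2 _ _ f I erefl)).
by rewrite rmorphK rmorph0 => /subr0_eq.
Qed.

Lemma tilted_range_linear d : linear_set (tilted_range d).
Proof.
split=> [|a _ _ [f _ <-] [g _ <-]].
  by exists 0 => //; rewrite !linear0.
exists (a *: f + g) => //; rewrite (linearP A) (linearP B) scalerDr opprD.
by rewrite scalerA mulrC -scalerA -scalerN.
Qed.

Lemma frakD_tilted d x : conj d = d -> d != 0 ->
  frakD A B x <-> exists g, tilted_adjoint d (x, g).
Proof.
move=> dd d0; rewrite frakDP; split=> -[g xg].
  exists (d^-1 *: g); apply/tilted_adjointE => // f.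
  by rewrite dotZr fmorphV /= dd mulVKf.
exists (d *: g) => f; rewrite dotZr dd.
by move/(tilted_adjointE _ _ dd): xg => ->.
Qed.

(** [x] is the first component of the orthogonal projection of [(k, 0)] onto
    [tilted_adjoint d]; with T the closure of L(A, B), this means that
    [x] is the value at [k] of (1 + TT* / d^2)^-1. *)
Definition resolvent (d : F) (k x : K) := exists2 g, tilted_adjoint d (x, g) &
  forall y h, tilted_adjoint d (y, h) -> inner (k - x) y = inner g h.

Lemma tilted_adjoint_linear d : linear_set (tilted_adjoint d).
Proof. exact: dot_orthocomp_linear. Qed.

Lemma resolvent_exists d k : exists x, resolvent d k x.
Proof.
have [[x g] Mp kp] := projection_exists (k, 0) (@pair_inner_complete R s K H)
  (tilted_adjoint_linear d).
exists x; exists g; first exact: approx_dot_orthocomp.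
move=> y h /kp; rewrite /= /pair_inner /= sub0r.
by rewrite dotNl => /subr0_eq.
Qed.

Lemma resolvent_linear d a k x l y :
  resolvent d k x -> resolvent d l y -> resolvent d (a *: k + l) (a *: x + y).
Proof.
move=> [g xg kx] [h yh ly]; exists (a *: g + h).
  exact: (tilted_adjoint_linear _).2 xg yh.
move=> z j zj; rewrite [in RHS]dotDl dotZl -(kx _ _ zj) -(ly _ _ zj).
by rewrite opprD addrACA -scalerBr [LHS]dotDl dotZl.
Qed.

Lemma resolvent_inner d k x : resolvent d k x ->
  exists2 g, tilted_adjoint d (x, g) & inner k x = `|x| ^+ 2 + `|g| ^+ 2.
Proof.
move=> [g xg kx]; exists g => //.
by move: (kx _ _ xg); rewrite dotBl !inner_norm => <-; rewrite addrC subrK.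
Qed.

Lemma resolvent_norm d k x : resolvent d k x -> `|x| <= `|k|.
Proof.
move=> /resolvent_inner[g _ kx]; have [->|x0] := eqVneq x 0; first by rewrite normr0.
rewrite -(@ler_pM2r _ `|x|) ?normr_gt0// -expr2.
apply: le_trans (inner_CauchySchwarz k x).
by rewrite kx ger0_norm ?addr_ge0 ?exprn_ge0// lerDl exprn_ge0.
Qed.

Lemma resolvent_uniq d k x y : resolvent d k x -> resolvent d k y -> x = y.
Proof.
move=> kx ky; have := resolvent_linear (-1) ky kx.
rewrite !scaleN1r addNr => /resolvent_norm.
by rewrite normr0 normr_le0 addrC subr_eq0 => /eqP.
Qed.

(** Taking the projection itself as test vector gives
    [`|x| ^+ 2 + `|g| ^+ 2 = d * inner (A f) g], and the arithmetic-geometric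
    mean inequality absorbs [`|g| ^+ 2]. *)
Lemma resolvent_dominated d f x : 0 < d -> resolvent d (B f) x ->
  `|x| <= d * `|A f|.
Proof.
move=> d0 /resolvent_inner[g xg Bx].
have dd : conj d = d by rewrite scalar_conj_ge0// ltW.
move/(tilted_adjointE _ _ dd) : xg => /(_ f); rewrite Bx => {}Bx.
have dA0 : 0 <= d * `|A f| by rewrite mulr_ge0// ltW.
rewrite -(@ler_pXn2r _ 2) ?nnegrE//.
rewrite -(lerD2r (`|g| ^+ 2)) Bx.
have AM_GM (a b : F) : 0 <= a -> 0 <= b -> a * b <= a ^+ 2 + b ^+ 2.
  move=> a0 b0; rewrite -subr_ge0 -(pmulrn_lge0 _ (isT : (0 < 2)%N)).
  rewrite [leRHS](_ : _ = (a - b) ^+ 2 + a ^+ 2 + b ^+ 2); last by ring.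
  have ab0 : 0 <= (a - b) ^+ 2 by rewrite real_exprn_even_ge0// rpredB ?ger0_real.
  by rewrite -addrA addr_ge0// addr_ge0// exprn_ge0.
apply: (@le_trans _ _ (d * `|A f| * `|g|)); last exact: AM_GM.
have Ag0 : 0 <= d * inner (A f) g by rewrite -Bx addr_ge0 ?exprn_ge0.
rewrite -[leLHS]ger0_norm// normrM [`|d|]ger0_norm ?(ltW d0)// -mulrA.
by rewrite ler_pM2l// inner_CauchySchwarz.
Qed.

(** Resolvent identity: with [r = d / e] and [z] the [d]-resolvent of [y],
    [x] is the convex combination [r ^+ 2 *: y + (1 - r ^+ 2) *: z], and the
    norm of [z] is at most that of [y]. *)
Lemma resolvent_le d e k x y : 0 < d -> d <= e ->
  resolvent d k x -> resolvent e k y -> `|x| <= `|y|.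
Proof.
move=> d0 de kx ky; have [z yz] := resolvent_exists d y.
have e0 := lt_le_trans d0 de.
have dd : conj d = d by rewrite scalar_conj_ge0// ltW.
have ee : conj e = e by rewrite scalar_conj_ge0// ltW.
have [r [r0 r1 dr]] : exists r, [/\ 0 <= r, r <= 1 & d = e * r].
  exists (d / e); rewrite divr_ge0 ?(ltW d0) ?(ltW e0)//.
  by rewrite ler_pdivrMr// mul1r de mulrC divfK// gt_eqF.
have rr : conj r = r by rewrite scalar_conj_ge0.
have kx' : resolvent d k (r ^+ 2 *: y + (1 - r ^+ 2) *: z).
  case: ky yz => [g yg ky] [w zw yz]; exists (r *: g + (1 - r ^+ 2) *: w).
    move/(tilted_adjointE _ _ ee) : yg => yg; move/(tilted_adjointE _ _ dd) : zw => zw.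
    apply/tilted_adjointE => // f; rewrite !dotDr !dotZr yg zw.
    rewrite rmorphB rmorph1 rmorphXn /= rr dr.
    by move: (inner _ _) (inner _ _) => a b; ring.
  move=> v h vh.
  have {}ky : inner (k - y) v = r * inner g h.
    rewrite -[r in RHS]rr -dotZr; apply: ky.
    move/(tilted_adjointE _ _ dd) : vh => vh; apply/tilted_adjointE => // f.
    by rewrite vh dotZr rr dr mulrA.
  rewrite [in RHS]dotDl !dotZl -(yz _ _ vh) -ky !dotBl !dotDl !dotZl.
  by move: (inner _ _) (inner _ _) (inner _ _) => a b c; ring.
rewrite (resolvent_uniq kx kx'); apply: (le_trans (ler_normD _ _)).
have r20 : 0 <= r ^+ 2 by rewrite exprn_ge0.
have r21 : 0 <= 1 - r ^+ 2 by rewrite subr_ge0 exprn_ile1.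
rewrite -[leRHS](_ : r ^+ 2 * `|y| + (1 - r ^+ 2) * `|y| = _).
  rewrite (normrZ (r ^+ 2)) (normrZ (1 - _)) (ger0_norm r20) (ger0_norm r21).
  by rewrite lerD2l ler_wpM2l// (resolvent_norm yz).
by rewrite -mulrDl subrKC mul1r.
Qed.

(** Pythagoras: the projection of [(k, 0)] is the closest point of
    [tilted_adjoint d]. *)
Lemma resolvent_min d k x y h : resolvent d k x -> tilted_adjoint d (y, h) ->
  `|k - x| ^+ 2 <= `|k - y| ^+ 2 + `|h| ^+ 2.
Proof.
move=> [g xg kx] yh.
have xy : tilted_adjoint d (x - y, g - h).
  rewrite (_ : (_, _) = -1 *: (y, h) + (x, g)).
    exact: (tilted_adjoint_linear _).2 yh xg.
  by rewrite scaleN1r [RHS]addrC.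
have xy0 : inner (k - x) (x - y) = inner g (g - h) := kx _ _ xy.
have -> : k - y = (k - x) + (x - y) by rewrite addrA subrK.
have -> : h = g - (g - h) by rewrite subKr.
rewrite -!inner_norm; move: (k - x) (x - y) (g - h) xy0 => u v w uv.
rewrite !(dotDl, dotDr) !(dotNl, dotNr) [inner v u]dotC uv [inner w g]dotC.
rewrite -subr_ge0 [leRHS](_ : _ = inner v v + (inner g g + inner w w)).
  by rewrite !addr_ge0 ?dot_ge0.
by move: (inner u u) (inner g w) (conj _) (inner g g) (inner w w) (inner v v) => *; ring.
Qed.

(** The first components of [tilted_adjoint d] lie in [frakD A B], so [(k, 0)]
    is orthogonal to it. *)
Lemma resolvent_ortho d k : d != 0 -> conj d = d -> orthocomp (frakD A B) k -> resolvent d k 0.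
Proof.
move=> d0 dd Dk; exists 0; first exact: (tilted_adjoint_linear _).1.
by move=> y h yh; rewrite subr0 dot0l Dk//; apply/(frakD_tilted _ dd) => //; exists h.
Qed.

Lemma frakD_linear : linear_set (frakD A B).
Proof.
have c1 : conj 1 = 1 by rewrite rmorph1.
split=> [|a x y]; rewrite !(frakD_tilted _ c1 (oner_neq0 _)).
  by exists 0; apply: (tilted_adjoint_linear _).1.
move=> [g xg] [h yh]; exists (a *: g + h); exact: (tilted_adjoint_linear _).2 xg yh.
Qed.

End operator_range.

(** * The Lebesgue decomposition *)

Section Lebesgue_decomposition.
Context (R : realType) (s : scalar_kind) (E H K : hilbertType R s).
Context (A : 'B(E, H)) (B : 'B(E, K)).
Local Notation F := (scalar_field R s).
Local Notation conj := (scalar_conj R s).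

Let P : 'B(K, K) := orthoproj (orthocomp (frakD A B)).
Let Breg : 'B(E, K) := (idfun \- P) \o B.
Let Bsing : 'B(E, K) := P \o B.

Lemma singP k : orthocomp (frakD A B) (P k).
Proof. by have [] := orthoproj_orthocompP (frakD_linear A B). Qed.

Lemma regP k : approx inner (frakD A B) (k - P k).
Proof. by have [] := orthoproj_orthocompP (frakD_linear A B). Qed.

Lemma norm_sing_le k : `|P k| <= `|k|.
Proof. by have [] := orthoproj_orthocompP (frakD_linear A B). Qed.

Lemma singK k : orthocomp (frakD A B) k -> P k = k.
Proof.
move=> Dk; apply/esym/subr0_eq/(approx_orthocomp0 (regP k)) => d Dd.
by rewrite dotBl Dk// singP// subrr.
Qed.

Lemma inner_regl f x : frakD A B x -> inner (Breg f) x = inner (B f) x.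
Proof. by move=> Dx; rewrite /Breg /= dotBl singP// subr0. Qed.

Lemma natr_conj n : conj n.+1%:R = n.+1%:R.
Proof. exact: rmorph_nat. Qed.

Lemma natr_neq0 n : n.+1%:R != 0 :> F.
Proof. by rewrite pnatr_eq0. Qed.

Lemma resolvent_reg n f x :
  resolvent A B n.+1%:R (B f) x -> resolvent A B n.+1%:R (Breg f) x.
Proof.
move=> Bx.
have Px0 := resolvent_ortho (natr_neq0 n) (natr_conj n) (@singP (B f)).
have := resolvent_linear (-1) Px0 Bx.
by rewrite !scaleN1r oppr0 add0r addrC.
Qed.

(** The approximants are the resolvents with parameters 1, 2, 3 and so on,
    composed with [B]. *)
Lemma almost_dominated_reg : almost_dominated Breg A.
Proof.
have /choice[C HC] (n : nat) : exists C : 'B(K, K), forall k, resolvent A B n.+1%:R k (C k).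
  apply: (@boundedOp_of_rel _ K K _ 1).
  - exact: resolvent_exists.
  - by move=> *; exact: resolvent_linear.
  - by move=> v w /resolvent_norm; rewrite mul1r.
exists (fun=> K), (fun n => C n \o B), (fun n => n.+1%:R); split=> // f; split.
- by move=> n; apply: resolvent_dominated (HC n _); rewrite /= ltr0n.
- by move=> n; apply: resolvent_le (HC n (B f)) (HC n.+1 (B f)); rewrite ?ltr0n ?ler_nat.
apply/cvgrPdist_lt => e e0; have e20 : 0 < e ^+ 2 / 2%:R by rewrite divr_gt0// exprn_gt0.
have [x Dx xf] := regP (B f) e20.
have [h xh] := (frakDP A B x).1 Dx.
have h0 : 0 < `|h| ^+ 2 + 1 by rewrite ltr_wpDl ?exprn_ge0.
(* Compare [(Breg f, 0)] with the point of the adjoint relation above an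
   element [x] of [frakD A B] close to [Breg f]: half of [e ^+ 2] is spent on
   [x], the other half on its second component, divided by [n.+1]. *)
have [|N hN] := @scalar_archi R s (e ^+ 2 / 2%:R / (`|h| ^+ 2 + 1)); first exact: divr_gt0.
exists N => // n /= Nn.
apply: (le_lt_trans (ler_dist_dist _ _)).
rewrite -(@ltr_pXn2r _ 2) ?nnegrE ?(ltW e0)//.
have n0 : n.+1%:R != 0 :> F by rewrite pnatr_eq0.
have xhn : tilted_adjoint A B n.+1%:R (x, n.+1%:R^-1 *: h).
  apply/tilted_adjointE; first exact: natr_conj.
  by move=> g; rewrite dotZr fmorphV /= natr_conj mulVKf.
apply: (le_lt_trans (resolvent_min (resolvent_reg (HC n _)) xhn)).
rewrite (splitr (e ^+ 2)) -inner_norm; apply: ltr_leD => //.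
rewrite normrZ exprMn.
have n1 : `|n.+1%:R^-1| ^+ 2 <= N.+1%:R^-1 :> F.
  rewrite ger0_norm ?invr_ge0 ?ler0n//.
  apply: (@le_trans _ _ (n.+1%:R^-1)).
    by rewrite expr2 ler_piMr ?invr_ge0 ?ler0n// invf_le1 ?ltr0n// ler1n.
  by rewrite lef_pV2 ?posrE ?ltr0n// ler_nat ltnS.
apply: (@le_trans _ _ (N.+1%:R^-1 * (`|h| ^+ 2 + 1))).
  apply: ler_pM; rewrite ?exprn_ge0//.
  by rewrite lerDl.
by rewrite -ler_pdivlMr// ltW.
Qed.

(** [(Bsing f, 0)] is a limit of pairs [(B g, - A g)]; along them [D g] tends
    to 0 by domination by [A], and [D (f - g)] by domination by [Bsing]. *)
Lemma singular_sing : singular Bsing A.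
Proof.
move=> D [c c0 DA] [d d0 DB] f.
apply/normr0_eq0; apply: scalar_approx0 => // e e0.
pose k := Bsing f.
have k_approx : approx (@pair_inner R s K H) (tilted_range A B 1) (k, 0).
  apply/(approx_biorthP _ (@pair_inner_complete R s K H) (tilted_range_linear _ _ _)).
  move=> [x g] xg; rewrite /= /pair_inner /= dot0l addr0; apply: singP.
  by apply/(frakD_tilted _ _ _ (rmorph1 _) (oner_neq0 _)); exists g.
have cd0 : 0 < c + d by rewrite addr_gt0.
have e1 : 0 < e / (c + d) by rewrite divr_gt0.
have [|_ [g _ <-]] := k_approx ((e / (c + d)) ^+ 2); first exact: exprn_gt0.
rewrite /= /pair_inner /= scale1r opprK add0r !inner_norm => small.
have small1 : `|k - B g| < e / (c + d).
  rewrite -(@ltr_pXn2r _ 2) ?nnegrE ?(ltW e1)//; apply: le_lt_trans small.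
  by rewrite lerDl exprn_ge0.
have small2 : `|A g| < e / (c + d).
  rewrite -(@ltr_pXn2r _ 2) ?nnegrE ?(ltW e1)//; apply: le_lt_trans small.
  by rewrite lerDr exprn_ge0.
rewrite -(subrK g f) linearD; apply: (le_lt_trans (ler_normD _ _)).
have -> : e = d * (e / (c + d)) + c * (e / (c + d)).
  by rewrite -mulrDl [d + c]addrC mulrC divfK// gt_eqF.
apply: ltrD.
  apply: (le_lt_trans (DB _)); rewrite ltr_pM2l//; apply: le_lt_trans small1.
  rewrite linearB /= -(singK (singP (B f))) -linearB.
  exact: norm_sing_le.
by apply: (le_lt_trans (DA _)); rewrite ltr_pM2l.
Qed.

Lemma closure_prod_dist (V W : normedModType F) (S : set (V * W)) p (e : F) :
  closure S p -> 0 < e -> exists2 q, S q & `|p.1 - q.1| < e /\ `|p.2 - q.2| < e.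
Proof.
move=> Sp e0; have [|q [Sq [q1 q2]]] := Sp [set q | ball p.1 e q.1 /\ ball p.2 e q.2].
  exists (ball p.1 e, ball p.2 e) => //=; split; exact: nbhsx_ballx.
by exists q => //; move: q1 q2; rewrite -!ball_normE.
Qed.

(** The vector [k - Breg f] is orthogonal to [frakD A B], since inner products
    with elements of [frakD A B] factor through [A], and it is also a limit of
    elements of [frakD A B]. *)
Lemma RN_derivative_single f k :
  RN_derivative A Breg (A f, k) -> k = Breg f.
Proof.
move=> cl; have clD e : 0 < e -> exists2 g, `|A f - A g| < e & `|k - Breg g| < e.
  by move=> /(closure_prod_dist cl)[_ [g _ <-] [? ?]]; exists g.
have inner_k x h : (forall g, inner (B g) x = inner (A g) h) ->
    inner (k - Breg f) x = 0.
  move=> xh; have Dx : frakD A B x by apply/frakDP; exists h.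
  apply/normr0_eq0/scalar_approx0 => // e e0.
  have c0 : 0 < `|x| + `|h| + 1 by rewrite ltr_wpDl// addr_ge0.
  have [|g gA gB] := clD (e / (`|x| + `|h| + 1)); first exact: divr_gt0.
  have -> : inner (k - Breg f) x = inner (k - Breg g) x - inner (A f - A g) h.
    rewrite (dotBl _ k (Breg f)) (dotBl _ k (Breg g)) (dotBl _ (A f)) !inner_regl// !xh.
    by rewrite opprB addrA subrK.
  apply: (le_lt_trans (ler_normB _ _)).
  apply: (@le_lt_trans _ _ (e / (`|x| + `|h| + 1) * (`|x| + `|h|))).
    rewrite mulrDr; apply: lerD; apply: (le_trans (inner_CauchySchwarz _ _));
    by rewrite ler_wpM2r// ltW.
  by rewrite -mulrA gtr_pMr// mulrC ltr_pdivrMr// mul1r ltrDl.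
apply/subr0_eq/(dot_eq0 (f := @inner R s K)).
have Dk : orthocomp (frakD A B) (k - Breg f) by move=> x /frakDP[h]; exact: inner_k.
have biorth := approx_biorthP _ (@inner_complete R s K) (frakD_linear A B).
apply: (approx_orthocomp _ Dk); apply/biorth => w Dw.
have Breg_w g : inner (Breg g) w = 0.
  by apply: (biorth _).1 Dw; exact: regP.
rewrite (dotBl _ k (Breg f)) Breg_w subr0.
apply/normr0_eq0/scalar_approx0 => // e e0.
have c0 : 0 < `|w| + 1 by rewrite ltr_wpDl.
have [|g _ gB] := clD (e / (`|w| + 1)); first exact: divr_gt0.
rewrite -(subrK (Breg g) k) dotDl Breg_w addr0.
apply: (le_lt_trans (inner_CauchySchwarz _ _)).
move: gB; rewrite ltr_pdivlMr//; apply: le_lt_trans.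
by rewrite ler_wpM2l// lerDl.
Qed.

End Lebesgue_decomposition.

Theorem theorem8p2 (R : realType) (s : scalar_kind) (E H K : hilbertType R s)
    (A : 'B(E, H)) (B : 'B(E, K)) :
  let P : 'B(K, K) := orthoproj (orthocomp (frakD A B)) in
  let Breg : 'B(E, K) := (idfun \- P) \o B in
  let Bsing : 'B(E, K) := P \o B in
  let Lreg : set (H * K) := op_mul_rel (idfun \- P) (opL A B) in
  let Lsing : set (H * K) := op_mul_rel P (opL A B) in
  [/\ almost_dominated Breg A,
      singular Bsing A,
      forall f, B f = Breg f + Bsing f,
      graph Breg = rel_comp (RN_derivative A Breg) (graph A) &
      Lreg = opL A Breg /\ Lsing = opL A Bsing ].
Proof.
move=> P Breg Bsing Lreg Lsing; split.
- exact: almost_dominated_reg.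
- exact: singular_sing.
- by move=> f; rewrite /Breg /Bsing /= subrK.
- apply/seteqP; rewrite /graph /rel_comp; split=> -[f k] /=.
    by move=> ->; exists (A f) => //; apply: subset_closure; exists f.
  by move=> [_ ->]; exact: RN_derivative_single.
- by split; rewrite /Lreg /Lsing /op_mul_rel /opL image_comp.
Qed.
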